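(* Let $G_1$ and $G_2$ be graphs with $m_1=|V(G_1)|$ and $m_2=|V(G_2)|$. Then $$\max\{\mathrm{fix}(G_1),\mathrm{fix}(G_2)\}\le \mathrm{fix}(G_1*G_2)\le m_1m_2-1.$$
   Context: All graphs are finite and simple. For graphs $G_1,G_2$, the co-normal product $G_1*G_2$ is the graph with vertex set $V(G_1)\times V(G_2)$ in which $(a,b)$ and $(c,d)$ are adjacent if and only if $a$ is adjacent to $c$ in $G_1$ or $b$ is adjacent to $d$ in $G_2$. For a graph $G$, a set $F\subseteq V(G)$ is a fixing set of $G$ if the only automorphism of $G$ that fixes every vertex of $F$ is the identity. The fixing number $\mathrm{fix}(G)$ is the minimum cardinality of a fixing set of $G$. *)

(* Defs.v *)
From mathcomp Require Import all_boot all_fingroup.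

Set Implicit Arguments.
Unset Strict Implicit.
Unset Printing Implicit Defensive.

Record sgraph := SGraph {
  vertex :> finType;
  adj : rel vertex;
  adj_sym : symmetric adj;
  adj_irrefl : irreflexive adj }.

Section Conormal.
Variables G1 G2 : sgraph.

Definition conormal_adj : rel (G1 * G2)%type :=
  fun u v => adj u.1 v.1 || adj u.2 v.2.

Lemma conormal_sym : symmetric conormal_adj.
Proof.
by move=> u v; rewrite /conormal_adj (adj_sym u.1) (adj_sym u.2).
Qed.

Lemma conormal_irrefl : irreflexive conormal_adj.
Proof. by move=> u; rewrite /conormal_adj !adj_irrefl. Qed.

Definition conormal : sgraph := SGraph conormal_sym conormal_irrefl.

End Conormal.

Section Fixing.
Variable G : sgraph.

Definition is_aut (s : {perm G}) : bool :=
  [forall x, forall y, adj (s x) (s y) == adj x y].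

Definition fixing_set (F : {set G}) : bool :=
  [forall s : {perm G},
     is_aut s && [forall x in F, s x == x] ==> (s == 1%g)].

Lemma fixing_setT : fixing_set [set: G].
Proof.
apply/forallP=> s; apply/implyP=> /andP[_ /forall_inP s_id].
by apply/eqP/permP=> x; rewrite perm1; apply/eqP/s_id; rewrite inE.
Qed.

(* By [fixing_setT] the default [set: G] of the arg min is a fixing set, so
   this is the minimum over all fixing sets. *)
Definition fixing_number : nat :=
  #|[arg min_(F < [set: G] | fixing_set F) #|F|]|.

End Fixing.

(* Main.v *)
(** An automorphism [s] of [G1] acts on the product as [s x id]; if [s] fixes the
first projection of a fixing set [F] pointwise, then [s x id] fixes [F]
pointwise. Hence projections of fixing sets are fixing sets. For the upper
bound, a permutation fixing all points but one is the identity. *)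
Require Import Defs.
From mathcomp Require Import all_boot all_fingroup.

Lemma fixing_setP (G : sgraph) (F : {set G}) :
  reflect (forall s : {perm G}, is_aut s -> {in F, forall x, s x = x} -> s = 1%g)
          (fixing_set F).
Proof.
apply: (iffP forallP) => [fixF s s_aut sF | fixF s].
  have /implyP := fixF s; rewrite s_aut /= => /(_ _)/eqP; apply.
  by apply/forall_inP=> x /sF ->.
apply/implyP=> /andP[s_aut /forall_inP sF]; apply/eqP/fixF => // x /sF.
by move/eqP.
Qed.

Lemma fixing_number_le (G : sgraph) (F : {set G}) :
  fixing_set F -> fixing_number G <= #|F|.
Proof.
rewrite /fixing_number; case: arg_minnP => [|A _ minA /minA //].
exact: fixing_setT.
Qed.

Lemma fixing_number_witness (G : sgraph) :
  exists2 F : {set G}, fixing_set F & #|F| = fixing_number G.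
Proof.
rewrite /fixing_number; case: arg_minnP => [|A fixA _]; last by exists A.
exact: fixing_setT.
Qed.

Lemma fixing_setC1 (G : sgraph) (a : G) : fixing_set [set~ a].
Proof.
apply/fixing_setP=> s _ s_id; apply/permP=> x; rewrite perm1.
have [->|xNa] := eqVneq x a; last by apply: s_id; rewrite !inE.
apply/eqP/negPn/negP=> saNa.
(* If [s a] differed from [a], it would lie in the set that [s] fixes pointwise; injectivity of [s]
   then gives [s a = a], a contradiction. *)
have /perm_inj sa : s (s a) = s a by apply: s_id; rewrite !inE.
by rewrite sa eqxx in saNa.
Qed.

Lemma fixing_number_ltn_card (G : sgraph) : 0 < #|G| -> fixing_number G <= #|G| - 1.
Proof.
case/card_gt0P=> a _; apply: leq_trans (fixing_number_le _ _ (fixing_setC1 G a)) _.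
by rewrite cardsC1 subn1.
Qed.

Section ProductAutomorphisms.
Variables G1 G2 : sgraph.

Definition prod_fun (s : {perm G1}) (t : {perm G2}) (u : conormal G1 G2) :
  conormal G1 G2 := (s u.1, t u.2).

Lemma prod_fun_inj s t : injective (prod_fun s t).
Proof. by move=> [a b] [c d] [/perm_inj -> /perm_inj ->]. Qed.

Definition prod_perm s t : {perm conormal G1 G2} := perm (@prod_fun_inj s t).

(** Adjacency in the product is a boolean function of the two coordinate adjacencies, and [s] and
    [t] preserve one each. *)
Lemma prod_perm_aut s t : is_aut s -> is_aut t -> is_aut (prod_perm s t).
Proof.
move=> /forallP s_aut /forallP t_aut; apply/forallP=> u; apply/forallP=> v.
rewrite !permE /= /conormal_adj /=.
by rewrite (eqP (forallP (s_aut _) _)) (eqP (forallP (t_aut _) _)).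
Qed.

Lemma perm1_aut (G : sgraph) : is_aut (1%g : {perm G}).
Proof. by apply/forallP=> x; apply/forallP=> y; rewrite !perm1. Qed.

(** A vertex of [G2] is what lets [s] be recovered from its action on the product. Were [G2] empty,
    the product would be empty and have the empty fixing set, whose projection need not fix [G1]. *)
Lemma fixing_set_fst (F : {set conormal G1 G2}) :
  0 < #|G2| -> fixing_set F -> fixing_set [set u.1 | u in F].
Proof.
case/card_gt0P=> b _ /fixing_setP fixF; apply/fixing_setP=> s s_aut s_id.
have /permP st1 : prod_perm s 1%g = 1%g.
  apply: fixF => [|[x y] Fu]; first exact: prod_perm_aut (perm1_aut _).
  by rewrite permE /prod_fun /= perm1 s_id //; apply: (imset_f fst Fu).
(* Evaluate at [(x, b)] and read off the first coordinate. *)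
by apply/permP=> x; have := st1 (x, b); rewrite permE !perm1 => -[].
Qed.

Lemma fixing_set_snd (F : {set conormal G1 G2}) :
  0 < #|G1| -> fixing_set F -> fixing_set [set u.2 | u in F].
Proof.
case/card_gt0P=> a _ /fixing_setP fixF; apply/fixing_setP=> t t_aut t_id.
have /permP st1 : prod_perm 1%g t = 1%g.
  apply: fixF => [|[x y] Fu]; first exact: prod_perm_aut (perm1_aut _) _.
  by rewrite permE /prod_fun /= perm1 t_id //; apply: (imset_f snd Fu).
by apply/permP=> y; have := st1 (a, y); rewrite permE !perm1 => -[].
Qed.

End ProductAutomorphisms.

Theorem theorem3p10 (G1 G2 : sgraph) (m1 m2 : nat)
    (hm1 : m1 = #|G1|) (hm2 : m2 = #|G2|)
    (G1_nonempty : 0 < #|G1|) (G2_nonempty : 0 < #|G2|) :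
  maxn (fixing_number G1) (fixing_number G2)
    <= fixing_number (conormal G1 G2) <= m1 * m2 - 1.
Proof.
have card_prodG : #|conormal G1 G2| = m1 * m2 by rewrite hm1 hm2 -card_prod.
apply/andP; split; last first.
  by rewrite -card_prodG fixing_number_ltn_card // card_prodG hm1 hm2 muln_gt0 G1_nonempty.
(* A single minimum fixing set [F] of the product serves both factors: each projection of [F] is a
   fixing set with at most [#|F|] elements. *)
have [F fixF <-] := fixing_number_witness (conormal G1 G2).
rewrite geq_max; apply/andP; split.
  apply: leq_trans (leq_imset_card _ _).
  exact: fixing_number_le (fixing_set_fst _ _ _ G2_nonempty fixF).
apply: leq_trans (leq_imset_card _ _).
exact: fixing_number_le (fixing_set_snd _ _ _ G1_nonempty fixF).
Qed.
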